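(* Let $\Phi=\forall x\forall y\,\alpha(x,y)\wedge\bigwedge_{i=1}^m\forall x\exists y\,\beta_i(x,y)$ be a two-variable first-order sentence in Scott normal form without the equality predicate, and let $\mathcal{G}_\Phi$ be its graph system. Then $\Phi$ is satisfiable if and only if $\mathcal{G}_\Phi$ has a good independent set (GIS).
   Context: The logic is relational first-order logic with only the two variables $x,y$ and only unary and binary predicates; $m\ge 1$; $\alpha$ and all $\beta_i$ are quantifier-free and equality-free. A 1-literal is an atom or negated atom using only the variable $x$ (including atoms $R(x,x)$ for binary $R$); a 2-literal is an atom $R(x,y)$ or $R(y,x)$ with $R$ binary, or its negation. A 1-type (2-type) is a maximally consistent set of 1-literals (2-literals) over the predicates of $\Phi$, identified with the conjunction of its elements and written $\pi(x)$ (resp. $\eta(x,y)$); $\pi(y)$ is $\pi(x)$ with $x$ replaced by $y$. Thus $\pi_1(x)\wedge\eta(x,y)\wedge\pi_2(y)$ is a full Boolean assignment to the atoms over $x,y$. A 1-type $\pi$ is compatible with $\alpha$ if there is a 2-type $\eta$ with $\pi(x)\wedge\eta(x,y)\wedge\pi(y)\models\alpha(x,y)$. A pair $(\pi_1,\pi_2)$ of (not necessarily different) 1-types is compatible with $\alpha$ if there is a 2-type $\eta$ with $\pi_1(x)\wedge\eta(x,y)\wedge\pi_2(y)\models\alpha(x,y)$, and incompatible with $\alpha$ otherwise. For $1\le i\le m$, a pair $(\pi_1,\pi_2)$ is $\beta_i$-compatible with $\alpha$ if there is a 2-type $\eta$ with $\pi_1(x)\wedge\eta(x,y)\wedge\pi_2(y)\models\alpha(x,y)\wedge\beta_i(x,y)$.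 The graph system $\mathcal{G}_\Phi=(G_0,G_1,\ldots,G_m)$ is a tuple of graphs over the same vertex set $V$, the set of 1-types compatible with $\alpha$. $G_0$ is an undirected graph in which $(\pi_1,\pi_2)$ is an edge if and only if $(\pi_1,\pi_2)$ is incompatible with $\alpha$. For $1\le i\le m$, $G_i$ is a directed graph (possibly with self-loops) in which $(\pi_1,\pi_2)$ is an edge if and only if $(\pi_1,\pi_2)$ is $\beta_i$-compatible with $\alpha$. A good independent set (GIS) is a non-empty $\Gamma\subseteq V$ that is independent in $G_0$ and such that for every $u\in\Gamma$ and every $1\le i\le m$ there is $v\in\Gamma$ (possibly $v=u$) with $(u,v)$ an edge of $G_i$.
   Formalization: The graph system is formed from α(x,y)∧α(y,x)∧α(x,x)∧α(y,y) in place of α(x,y); as written the claim fails, e.g. for α = (R(x,y) ↔ ¬R(x,x)), β_1 = true, where Φ is unsatisfiable but {R(x,x)} gives a GIS. *)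

(* Defs.v *)
From mathcomp Require Import all_boot.
Set Implicit Arguments.
Unset Strict Implicit.
Unset Printing Implicit Defensive.

(* Two-variable first-order logic without equality, over a signature of unary
   predicates U and binary predicates B. *)

Inductive var := X | Y.

Inductive fo2 (U B : Type) :=
| Tru
| Un of U & var
| Bin of B & var & var
| Neg of fo2 U B
| And of fo2 U B & fo2 U B
| Or of fo2 U B & fo2 U B
| All of var & fo2 U B
| Ex of var & fo2 U B.

Arguments Tru {U B}.
Arguments Un {U B} _ _.
Arguments Bin {U B} _ _ _.

Fixpoint quantifier_free (U B : Type) (f : fo2 U B) : bool :=
  match f with
  | Tru | Un _ _ | Bin _ _ _ => true
  | Neg g => quantifier_free g
  | And g h | Or g h => quantifier_free g && quantifier_free h
  | All _ _ | Ex _ _ => false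
  end.

Record structure (U B : Type) := Structure {
  dom :> Type;
  dom_nonempty : inhabited dom;
  un : U -> dom -> Prop;
  bin : B -> dom -> dom -> Prop
}.

Definition upd (D : Type) (e : var -> D) (v : var) (d : D) : var -> D :=
  fun w => match v, w with X, X | Y, Y => d | _, _ => e w end.

Fixpoint holds (U B : Type) (M : structure U B) (e : var -> M) (f : fo2 U B)
    : Prop :=
  match f with
  | Tru => True
  | Un u v => un u (e v)
  | Bin b v w => bin b (e v) (e w)
  | Neg g => ~ holds e g
  | And g h => holds e g /\ holds e h
  | Or g h => holds e g \/ holds e h
  | All v g => forall d : M, holds (upd e v d) g
  | Ex v g => exists d : M, holds (upd e v d) g
  end.

Definition satisfiable (U B : Type) (f : fo2 U B) : Prop :=
  exists (M : structure U B) (e : var -> M), holds e f.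

Definition entails (U B : Type) (f g : fo2 U B) : Prop :=
  forall (M : structure U B) (e : var -> M), holds e f -> holds e g.

Definition conjs (U B : Type) (fs : seq (fo2 U B)) : fo2 U B :=
  foldr (@And U B) Tru fs.

Definition scott (U B : Type) (m : nat) (alpha : fo2 U B)
    (beta : 'I_m -> fo2 U B) : fo2 U B :=
  And (All X (All Y alpha))
      (conjs [seq All X (Ex Y (beta i)) | i <- enum 'I_m]).

(* Renaming of the variables by s. It does not avoid capture by quantifiers:
   only its values on quantifier-free formulas are meaningful. *)
Fixpoint rename (U B : Type) (s : var -> var) (f : fo2 U B) : fo2 U B :=
  match f with
  | Tru => Tru
  | Un u v => Un u (s v)
  | Bin b v w => Bin b (s v) (s w)
  | Neg g => Neg (rename s g)
  | And g h => And (rename s g) (rename s h)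
  | Or g h => Or (rename s g) (rename s h)
  | All v g => All v (rename s g)
  | Ex v g => Ex v (rename s g)
  end.

Definition swap (v : var) : var := match v with X => Y | Y => X end.

(* alpha(x,y) /\ alpha(y,x) /\ alpha(x,x) /\ alpha(y,y): the conjunction of all
   instances of alpha over {x,y}, so that the sentence "for all x, y, alpha" is
   unchanged up to equivalence. A graph system must be formed with it: alpha(x,y)
   alone ignores alpha(x,x) and constrains the two orientations of a pair
   separately, so that e.g. alpha := R(x,y) <-> ~ R(x,x) would give a good
   independent set although the sentence has no model. *)
Definition all_instances (U B : Type) (alpha : fo2 U B) : fo2 U B :=
  conjs [:: alpha; rename swap alpha;
           rename (fun=> X) alpha; rename (fun=> Y) alpha].

(* Literals. The leading boolean is the polarity; (s, inl u) stands for u(x),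
   (s, inr b) for b(x,x), (s, (b, true)) for b(x,y), (s, (b, false)) for b(y,x). *)

Definition lit1 (U B : finType) : finType := (bool * (U + B))%type.
Definition lit2 (B : finType) : finType := (bool * (B * bool))%type.

Definition signed (U B : Type) (s : bool) (f : fo2 U B) : fo2 U B :=
  if s then f else Neg f.

Definition lit1_fo (U B : finType) (v : var) (l : lit1 U B) : fo2 U B :=
  signed l.1 (match l.2 with inl u => Un u v | inr b => Bin b v v end).

Definition lit2_fo (U B : finType) (l : lit2 B) : fo2 U B :=
  signed l.1 (if l.2.2 then Bin l.2.1 X Y else Bin l.2.1 Y X).

Definition type1_fo (U B : finType) (v : var) (p : {set lit1 U B}) : fo2 U B :=
  conjs [seq lit1_fo v l | l <- enum p].

Definition type2_fo (U B : finType) (eta : {set lit2 B}) : fo2 U B :=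
  conjs [seq lit2_fo U l | l <- enum eta].

Definition maximal_satisfying (T : finType) (P : {set T} -> Prop) (A : {set T})
    : Prop :=
  P A /\ forall A' : {set T}, P A' -> A \subset A' -> A' = A.

Definition is_type1 (U B : finType) : {set lit1 U B} -> Prop :=
  maximal_satisfying (fun p => satisfiable (type1_fo X p)).

Definition is_type2 (U B : finType) : {set lit2 B} -> Prop :=
  maximal_satisfying (fun eta => satisfiable (type2_fo U eta)).

(* There is a 2-type eta with p1(x) /\ eta(x,y) /\ p2(y) |= g(x,y). *)
Definition compatible (U B : finType) (g : fo2 U B) (p1 p2 : {set lit1 U B})
    : Prop :=
  exists eta : {set lit2 B},
    is_type2 U eta /\
    entails (And (type1_fo X p1) (And (type2_fo U eta) (type1_fo Y p2))) g.

Record graphs (T : Type) (m : nat) := Graphs {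
  vertex : T -> Prop;
  edge0 : T -> T -> Prop;
  edge : 'I_m -> T -> T -> Prop
}.

Definition graph_system (U B : finType) (m : nat) (alpha : fo2 U B)
    (beta : 'I_m -> fo2 U B) : graphs {set lit1 U B} m :=
  {| vertex p := is_type1 p /\ compatible alpha p p;
     edge0 p1 p2 := ~ compatible alpha p1 p2;
     edge i p1 p2 := compatible (And alpha (beta i)) p1 p2 |}.

Definition good_independent_set (T : finType) (m : nat) (G : graphs T m)
    (Gamma : {set T}) : Prop :=
  [/\ Gamma != set0,
      forall u, u \in Gamma -> vertex G u,
      forall u v, u \in Gamma -> v \in Gamma -> ~ edge0 G u v
    & forall u, u \in Gamma ->
        forall i, exists2 v, v \in Gamma & edge G i u v].

(* Main.v *)
(* A model of the sentence yields the set of 1-types realised in it: the 2-type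
   of a pair of elements, together with their 1-types, decides every
   quantifier-free formula at that pair.  Conversely, label the natural numbers
   by pairs (1-type in Gamma, index i) so that every label occurs infinitely
   often.  For k < n with n labelled (q, i), join k to n by a 2-type witnessing
   beta_i if one is available, and by any 2-type compatible with alpha
   otherwise.  Each pair of numbers receives a single 2-type, and every k finds
   its beta_i-witness among the larger numbers. *)
Require Import Defs.
From mathcomp Require Import all_boot.
From mathcomp Require Import boolp.

Set Implicit Arguments.
Unset Strict Implicit.
Unset Printing Implicit Defensive.

(** * Quantifier-free truth and the Scott sentence *)

Definition pair_env (D : Type) (a b : D) (v : var) : D :=
  match v with X => a | Y => b end.

Section Semantics.
Variables U B : Type.
Implicit Types (f g : fo2 U B) (M : structure U B).

(** The two structures may differ, so types read off in one model can decide a formula in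
    another. *)
Lemma holds_qf_agree M M' (e : var -> M) (e' : var -> M') g :
  quantifier_free g ->
  (forall u v, un u (e v) <-> un u (e' v)) ->
  (forall b v w, bin b (e v) (e w) <-> bin b (e' v) (e' w)) ->
  holds e g <-> holds e' g.
Proof.
move=> + eU eB; elim: g => //= [g IH|g IHg h IHh|g IHg h IHh].
- by move=> /IH ->.
- by move=> /andP[/IHg -> /IHh ->].
- by move=> /andP[/IHg -> /IHh ->].
Qed.

Lemma holds_qf_env M (e e' : var -> M) g :
  quantifier_free g -> e =1 e' -> holds e g <-> holds e' g.
Proof. by move=> qf ee'; apply: holds_qf_agree => // *; rewrite !ee'. Qed.

Lemma quantifier_free_rename s g :
  quantifier_free (rename s g) = quantifier_free g.
Proof. by elim: g => //= g -> // h ->. Qed.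

Lemma holds_rename M (e : var -> M) s g :
  quantifier_free g -> holds e (rename s g) <-> holds (e \o s) g.
Proof.
elim: g => //= [g IH|g IHg h IHh|g IHg h IHh].
- by move=> /IH ->.
- by move=> /andP[/IHg -> /IHh ->].
- by move=> /andP[/IHg -> /IHh ->].
Qed.

Lemma quantifier_free_all_instances g :
  quantifier_free g -> quantifier_free (all_instances g).
Proof. by move=> qf; rewrite /= !quantifier_free_rename qf. Qed.

Lemma holds_all_instances M (a b : M) g : quantifier_free g ->
  holds (pair_env a b) (all_instances g) <->
  [/\ holds (pair_env a b) g, holds (pair_env b a) g,
      holds (pair_env a a) g & holds (pair_env b b) g].
Proof.
move=> qf; rewrite /all_instances /= !holds_rename //.
rewrite (@holds_qf_env _ (pair_env a b \o swap) (pair_env b a)) //; last by case.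
rewrite (@holds_qf_env _ (pair_env a b \o fun=> X) (pair_env a a)) //;
  last by case.
rewrite (@holds_qf_env _ (pair_env a b \o fun=> Y) (pair_env b b)) //;
  last by case.
by split=> [[? [? [? [? _]]]]|[]].
Qed.

Lemma holds_conjs (T : eqType) M (e : var -> M) (F : T -> fo2 U B) (s : seq T) :
  holds e (conjs [seq F x | x <- s]) <-> forall x, x \in s -> holds e (F x).
Proof.
elim: s => [|x s IH] //=; split=> [[Fx /IH Fs] y|Fxs].
  by rewrite inE => /predU1P[->|/Fs].
split; first by apply: Fxs; rewrite mem_head.
by apply/IH => y ys; apply: Fxs; rewrite inE ys orbT.
Qed.

Lemma holds_scott m M (e : var -> M) (alpha : fo2 U B)
    (beta : 'I_m -> fo2 U B) :
  quantifier_free alpha -> (forall i, quantifier_free (beta i)) ->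
  holds e (scott alpha beta) <->
  (forall a b : M, holds (pair_env a b) alpha) /\
  (forall i (a : M), exists b, holds (pair_env a b) (beta i)).
Proof.
move=> qfa qfb.
have envE (a b : M) : upd (upd e X a) Y b =1 pair_env a b by case.
rewrite /scott /= holds_conjs; split=> -[Ha Hb]; split.
- by move=> a b; apply/(holds_qf_env qfa (envE a b)).
- move=> i a; have [b Hab] := Hb i (mem_enum _ i) a.
  by exists b; apply/(holds_qf_env (qfb i) (envE a b)).
- by move=> a b; apply/(holds_qf_env qfa (envE a b)).
- move=> i _ a; have [b Hab] := Hb i a.
  by exists b; apply/(holds_qf_env (qfb i) (envE a b)).
Qed.

End Semantics.

(** * Diagrams over an arbitrary finite family of atoms *)

Section Diagrams.
Variables (U B A : finType) (atom : A -> fo2 U B).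
Implicit Types M : structure U B.

Definition literals_fo (p : {set bool * A}) : fo2 U B :=
  conjs [seq signed l.1 (atom l.2) | l <- enum p].

Definition diagram (M : structure U B) (e : var -> M) : {set bool * A} :=
  [set l | `[< holds e (signed l.1 (atom l.2)) >]].

Lemma holds_literals M (e : var -> M) (p : {set bool * A}) :
  holds e (literals_fo p) <->
  forall l, l \in p -> holds e (signed l.1 (atom l.2)).
Proof.
rewrite /literals_fo holds_conjs.
by split=> H l lp; apply: H; rewrite ?mem_enum // -mem_enum.
Qed.

Lemma holds_diagram M (e : var -> M) : holds e (literals_fo (diagram e)).
Proof. by apply/holds_literals => l; rewrite inE => /asboolP. Qed.

(** A diagram contains each atom or its negation; the negative literals give the direction from [e']
    back to [e]. *)
Lemma holds_literals_diagram M (e : var -> M) M' (e' : var -> M') :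
  holds e' (literals_fo (diagram e)) <->
  forall x, holds e (atom x) <-> holds e' (atom x).
Proof.
rewrite holds_literals; split=> [H x|H [[] x]]; last 2 first.
- by rewrite inE => /asboolP /= /H.
- by rewrite inE => /asboolP /=; rewrite H.
split=> [ex|e'x]; first by apply: (H (true, x)); rewrite inE; apply/asboolP.
apply: contrapT => nex.
by apply: (H (false, x) _ e'x); rewrite inE; apply/asboolP.
Qed.

(** A satisfiable set lies inside the diagram of its model, so maximality forces equality.
    Conversely, a model of a superset of a diagram agrees with it on all atoms, so no literal can be
    added. *)
Lemma maximal_satisfying_diagram (p : {set bool * A}) :
  maximal_satisfying (fun p => satisfiable (literals_fo p)) p <->
  exists (M : structure U B) (e : var -> M), p = diagram e.
Proof.
split=> [[[M [e pe]] pmax]|[M [e ->]]].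
  exists M, e; apply/esym/pmax; first by exists M, e; exact: holds_diagram.
  apply/subsetP => l; rewrite inE.
  by move=> /(iffLR (holds_literals _ _) pe) /asboolP.
split; first by exists M, e; exact: holds_diagram.
move=> q [M' [e' q_e']] /subsetP sub; apply/eqP; rewrite eqEsubset.
apply/andP; split; last exact/subsetP.
have /holds_literals_diagram agree : holds e' (literals_fo (diagram e)).
  by apply/holds_literals => l /sub /(iffLR (holds_literals _ _) q_e').
apply/subsetP => -[b x] /(iffLR (holds_literals _ _) q_e') H.
by rewrite inE; apply/asboolP; case: b H => /=; rewrite agree.
Qed.

End Diagrams.

(** * 1-types and 2-types as diagrams of elements and pairs *)

Section Types.
Variables U B : finType.
Implicit Types (g : fo2 U B) (M : structure U B).

Definition atom1 (v : var) (x : U + B) : fo2 U B :=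
  match x with inl u => Un u v | inr b => Bin b v v end.

Definition atom2 (x : B * bool) : fo2 U B :=
  if x.2 then Bin x.1 X Y else Bin x.1 Y X.

Definition type1 M (a : M) : {set lit1 U B} :=
  diagram (atom1 X) (fun=> a).

Definition type2 M (a b : M) : {set lit2 B} := diagram atom2 (pair_env a b).

Lemma is_type1P (p : {set lit1 U B}) :
  is_type1 p <-> exists M (a : M), p = type1 a.
Proof.
(* [type1_fo X] and [literals_fo (atom1 X)] are convertible. *)
rewrite -[is_type1 p]/(maximal_satisfying
  (fun p => satisfiable (literals_fo (atom1 X) p)) p).
rewrite maximal_satisfying_diagram; split=> [[M [e ->]]|[M [a ->]]].
  by exists M, (e X); apply/setP => -[b x]; rewrite !inE; case: b x => -[].
by exists M, (fun=> a).
Qed.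

Lemma is_type2P (eta : {set lit2 B}) :
  is_type2 U eta <-> exists M (a b : M), eta = type2 a b.
Proof.
rewrite -[is_type2 U eta]/(maximal_satisfying
  (fun p => satisfiable (literals_fo atom2 p)) eta).
rewrite maximal_satisfying_diagram; split=> [[M [e ->]]|[M [a [b ->]]]].
  exists M, (e X), (e Y).
  by apply/setP => -[s [b d]]; rewrite !inE; case: s d => -[].
by exists M, (pair_env a b).
Qed.

Lemma holds_type1 M (a : M) M' (e : var -> M') v :
  holds e (type1_fo v (type1 a)) <->
  (forall u, un u a <-> un u (e v)) /\
  (forall b, bin b a a <-> bin b (e v) (e v)).
Proof.
have -> : holds e (type1_fo v (type1 a)) <->
    holds (fun=> e v) (literals_fo (atom1 X) (type1 a)).
  rewrite /type1_fo holds_conjs holds_literals.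
  split=> H l; [have := H l | have := H l]; rewrite mem_enum => {}H /H;
    by case: l {H} => -[] [].
rewrite holds_literals_diagram; split=> [H|[HU HB] [u|b]]; last 2 first.
- exact: HU.
- exact: HB.
by split=> [u|b]; [exact: (H (inl u))|exact: (H (inr b))].
Qed.

Lemma holds_type2 M (a b : M) M' (e : var -> M') :
  holds e (type2_fo U (type2 a b)) <->
  forall r,
    (bin r a b <-> bin r (e X) (e Y)) /\ (bin r b a <-> bin r (e Y) (e X)).
Proof.
rewrite -[type2_fo _ _]/(literals_fo atom2 _) holds_literals_diagram.
split=> H r; first by split; [exact: (H (r, true))|exact: (H (r, false))].
by case: r => r [] /=; have [] := H r.
Qed.

(** The witness is the 2-type of the pair itself: the 1-types fix the unary and diagonal atoms, the
    2-type the mixed ones. *)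
Lemma compatible_realised M (a b : M) g :
  quantifier_free g -> holds (pair_env a b) g ->
  compatible g (type1 a) (type1 b).
Proof.
move=> qf Hg; exists (type2 a b); split; first by apply/is_type2P; exists M, a, b.
move=> M' e [/holds_type1 [aU aB] [/holds_type2 ab /holds_type1 [bU bB]]].
apply: iffLR Hg; apply: holds_qf_agree => //; first by move=> u [].
by move=> r [] [] //=; have [] := ab r.
Qed.

End Types.

(** * Structures on the natural numbers with prescribed types *)

Lemma infinitely_often_labelling (K : finType) (k0 : K) :
  exists f : nat -> K, forall k n, exists2 n', n < n' & f n' = k.
Proof.
have K_gt0 : 0 < size (enum K) by rewrite -cardE; apply/card_gt0P; exists k0.
exists (fun n => nth k0 (enum K) (n %% size (enum K))) => k n.
have ik : index k (enum K) < size (enum K) by rewrite index_mem mem_enum.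
(* Congruent to the index of [k] modulo the period, and above [n] because the period is positive. *)
exists (n.+1 * size (enum K) + index k (enum K)).
  by rewrite (leq_trans (leq_pmulr n.+1 K_gt0)) ?leq_addr.
by rewrite modnMDl modn_small // nth_index ?mem_enum.
Qed.

Section Model.
Variables (U B : finType) (tp : nat -> {set lit1 U B}).
Variable eta : nat -> nat -> {set lit2 B}.
Hypothesis tp_type1 : forall n, is_type1 (tp n).
Hypothesis eta_type2 : forall k n, is_type2 U (eta k n).

(** Only [eta k n] with [k < n] is consulted: the smaller number plays [X], so the flag [false]
    gives the atoms from larger to smaller. *)
Definition nat_model : structure U B := {|
  dom := nat;
  dom_nonempty := inhabits 0;
  un u n := (true, inl u) \in tp n;
  bin r k n := if k < n then (true, (r, true)) \in eta k n
               else if n < k then (true, (r, false)) \in eta n k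
               else (true, inr r) \in tp n
|}.

(** The model records positive literals only; since types are diagrams, a missing positive literal
    is present negated, so the prescribed types are realised exactly. *)
Lemma nat_model_entails g (k n : nat) : k < n ->
  entails (And (type1_fo X (tp k)) (And (type2_fo U (eta k n))
    (type1_fo Y (tp n)))) g ->
  holds (M := nat_model) (pair_env k n) g.
Proof.
have tpP (j : nat) (e : var -> nat_model) v : e v = j ->
    holds e (type1_fo v (tp j)).
  move=> evj; have /is_type1P [M [a tpa]] := tp_type1 j; rewrite tpa.
  apply/holds_type1; rewrite evj.
  split=> [u|r] /=; rewrite ?ltnn tpa inE; split=> [H|/asboolP //]; exact/asboolP.
move=> kn; apply; split; first exact: tpP.
split; last exact: tpP.
have /is_type2P [M [a [b etaE]]] := eta_type2 k n; rewrite etaE.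
apply/holds_type2 => r /=; rewrite kn ltnNge (ltnW kn) /= etaE !inE.
by split; split=> [H|/asboolP //]; exact/asboolP.
Qed.

End Model.

(** * From models to good independent sets and back *)

Section GraphSystem.
Variables (U B : finType) (m : nat) (alpha : fo2 U B) (beta : 'I_m -> fo2 U B).
Hypothesis alpha_qf : quantifier_free alpha.
Hypothesis beta_qf : forall i, quantifier_free (beta i).

Local Notation G := (graph_system (all_instances alpha) beta).

Lemma gis_of_model : satisfiable (scott alpha beta) ->
  exists Gamma, good_independent_set G Gamma.
Proof.
move=> [M [e /(holds_scott _ alpha_qf beta_qf) [Ha Hb]]].
have Hai (a b : M) : holds (pair_env a b) (all_instances alpha).
  exact/holds_all_instances.
have comp (a b : M) : compatible (all_instances alpha) (type1 a) (type1 b).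
  exact/compatible_realised/Hai/quantifier_free_all_instances.
exists [set p | `[< exists a : M, p = type1 a >]]; split.
- have [a] := dom_nonempty M; apply/set0Pn; exists (type1 a).
  by rewrite inE; apply/asboolP; exists a.
- move=> p; rewrite inE => /asboolP [a ->]; split=> //.
  by apply/is_type1P; exists M, a.
(* The goal is a doubly negated instance of [comp]. *)
- by move=> p q; rewrite !inE => /asboolP [a ->] /asboolP [b ->]; apply.
- move=> p; rewrite inE => /asboolP [a ->] i; have [b Hab] := Hb i a.
  exists (type1 b); first by rewrite inE; apply/asboolP; exists b.
  apply: compatible_realised => //.
  by apply/andP; split=> //; exact: quantifier_free_all_instances.
Qed.

Lemma model_of_gis Gamma : 0 < m -> good_independent_set G Gamma ->
  satisfiable (scott alpha beta).
Proof.
move=> m_gt0 [/set0Pn [p0 p0G] vert indep succ].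
have [f fP] := infinitely_often_labelling (p0, Ordinal m_gt0).
(* Labels range over all sets of 1-literals; those outside [Gamma] are sent to [p0]. *)
pose tp n := if (f n).1 \in Gamma then (f n).1 else p0.
have tpG n : tp n \in Gamma by rewrite /tp; case: ifP.
pose joins k n eta h := entails (And (type1_fo X (tp k)) (And (type2_fo U eta)
  (type1_fo Y (tp n)))) h.
(* The label of the second number alone selects which [beta] to witness. *)
have /choice [eta etaP] : forall kn : nat * nat, exists eta : {set lit2 B},
    [/\ is_type2 U eta, joins kn.1 kn.2 eta (all_instances alpha)
      & edge G (f kn.2).2 (tp kn.1) (tp kn.2) ->
        joins kn.1 kn.2 eta (beta (f kn.2).2)].
  move=> [k n] /=.
  have [[eta [eta2 etaE]]|noedge] :=
    pselect (edge G (f n).2 (tp k) (tp n)).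
    by exists eta; split=> // [|_] M e /etaE [].
  (* Without an edge, independence in [edge0] still yields a 2-type for [alpha]. *)
  have /contrapT [eta [eta2 etaE]] := indep _ _ (tpG k) (tpG n).
  by exists eta; split.
pose M := nat_model tp (fun k n => eta (k, n)).
have holdsM k n g : k < n -> joins k n (eta (k, n)) g ->
    holds (M := M) (pair_env k n) g.
  move=> kn; apply: nat_model_entails => // [j|i j].
    by have [] := vert _ (tpG j).
  by have [] := etaP (i, j).
have inst (k n : nat) : k < n ->
    [/\ holds (M := M) (pair_env k n) alpha, holds (M := M) (pair_env n k) alpha,
        holds (M := M) (pair_env k k) alpha & holds (M := M) (pair_env n n) alpha].
  move=> kn; apply/(holds_all_instances (M := M) k n alpha_qf)/holdsM => //.
  by have [] := etaP (k, n).
exists M, (fun=> 0); apply/holds_scott => //; split.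
  move=> k n; case: (ltngtP k n) => [/inst[]|/inst[]|->] //.
  (* The diagonal instance comes from the pair of [n] and its successor. *)
  by have [] := inst n n.+1 (leqnn _).
move=> i k; have [q qG kq] := succ _ (tpG k) i.
have [n kn fn] := fP (q, i) k; exists n; apply: holdsM => //.
(* As [n] is labelled [(q, i)] and [q] lies in [Gamma], [tp n] is [q], and [kq] is the required
   edge. *)
by have [_ _] := etaP (k, n); rewrite /= {2}/tp fn /= qG; apply.
Qed.

End GraphSystem.

Theorem lemma3p1 (U B : finType) (m : nat) (alpha : fo2 U B)
    (beta : 'I_m -> fo2 U B) (m_ge1 : 1 <= m)
    (alpha_qf : quantifier_free alpha)
    (beta_qf : forall i : 'I_m, quantifier_free (beta i)) :
  satisfiable (scott alpha beta) <->
  exists Gamma : {set {set lit1 U B}},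
    good_independent_set (graph_system (all_instances alpha) beta) Gamma.
Proof.
split=> [|[Gamma]]; first exact: gis_of_model.
exact: model_of_gis.
Qed.
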